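(* Let $r^e=m\ge-1$, $r^v\ge\max\{2r^e,-1\}$, and let $k$ be a nonnegative integer with $k\ge2r^v+1\ge4m+1$. Let $T$ be a triangle. Then $$\mathbb T^2_k(T)=S_0(T)\oplus S_1(T)\oplus S_2(T)$$ (disjoint union), where $$S_0(T):=D(\Delta_0(T),r^v),\qquad S_1(T):=\bigoplus_{e\in\Delta_1(T)}\big(D(e,r^e)\setminus S_0(T)\big),\qquad S_2(T):=\mathbb T^2_k(T)\setminus(S_0(T)\oplus S_1(T)),$$ the union over edges in the definition of $S_1(T)$ also being disjoint, with cardinalities $$|S_0(T)|=3\binom{r^v+2}{2},\qquad |S_1(T)|=3\sum_{i=0}^{r^e}(k-1-2r^v+i),\qquad |S_2(T)|=\binom{k+2}{2}-|S_0(T)|-|S_1(T)|.$$ This leads to the decomposition $$\mathbb P_k(T)=\mathbb P_k(S_0(T))\oplus\mathbb P_k(S_1(T))\oplus\mathbb P_k(S_2(T)).$$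
   Context: $\mathbb P_k(T)$ is the space of real polynomials of degree at most $k$ on $T$. The simplicial lattice is $\mathbb T^2_k=\mathbb T_k^2(T)=\{\alpha=(\alpha_0,\alpha_1,\alpha_2)\in\mathbb N^3:\alpha_0+\alpha_1+\alpha_2=k\}$ ($0\in\mathbb N$), indices corresponding to the vertices $v_0,v_1,v_2$ of $T$. $\Delta_0(T)$ and $\Delta_1(T)$ are the sets of vertices and edges of $T$. For a vertex or edge $f$ of $T$, $\operatorname{dist}(\alpha,f)=\sum_{i:\,v_i\notin f}\alpha_i$ and $D(f,r)=\{\alpha\in\mathbb T^2_k:\operatorname{dist}(\alpha,f)\le r\}$ (empty if $r=-1$); $D(\Delta_0(T),r)=\bigcup_{v\in\Delta_0(T)}D(v,r)$. With barycentric coordinates $\lambda_0,\lambda_1,\lambda_2$ of $T$, $\lambda^\alpha=\lambda_0^{\alpha_0}\lambda_1^{\alpha_1}\lambda_2^{\alpha_2}$, and for $S\subseteq\mathbb T_k^2$, $\mathbb P_k(S)=\operatorname{span}\{\lambda^\alpha:\alpha\in S\}$. Empty sums are $0$. *)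

(* Defs.v *)
From mathcomp Require Import all_boot all_order all_algebra.
From mathcomp Require Import reals ring.
From mathcomp.multinomials Require Import mpoly.

Set Implicit Arguments.
Unset Strict Implicit.
Unset Printing Implicit Defensive.

Import Order.TTheory GRing.Theory Num.Theory.
Local Open Scope ring_scope.

Section Lattice.
Variable k : nat.

Definition lattice : {set 'X_{1..3 < k.+1}} :=
  [set a : 'X_{1..3 < k.+1} | mdeg a == k].

(* The sub-simplices of dimension l, given by the indices of their vertices. *)
Definition faces (l : nat) : {set {set 'I_3}} :=
  [set f : {set 'I_3} | #|f| == l.+1].

Definition dist (a : 'X_{1..3 < k.+1}) (f : {set 'I_3}) : nat :=
  (\sum_(i | i \notin f) a i)%N.

Definition nbhd (f : {set 'I_3}) (r : int) : {set 'X_{1..3 < k.+1}} :=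
  [set a in lattice | (dist a f)%:Z <= r].

Definition S0 (rv : int) : {set 'X_{1..3 < k.+1}} :=
  \bigcup_(f in faces 0) nbhd f rv.

Definition S1_edge (rv re : int) (e : {set 'I_3}) : {set 'X_{1..3 < k.+1}} :=
  nbhd e re :\: S0 rv.

Definition S1 (rv re : int) : {set 'X_{1..3 < k.+1}} :=
  \bigcup_(e in faces 1) S1_edge rv re e.

Definition S2 (rv re : int) : {set 'X_{1..3 < k.+1}} :=
  lattice :\: (S0 rv :|: S1 rv re).

End Lattice.

Section Polynomials.
Variable R : realType.
Implicit Type v : 'I_3 -> 'rV[R]_2.

Definition is_triangle v : Prop :=
  free [:: v (inord 1) - v (inord 0); v (inord 2) - v (inord 0)].

Definition vertex_mx v : 'M[R]_(3, 2 + 1) :=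
  row_mx (\matrix_i v i) (const_mx 1).

(* The row vector of barycentric coordinates of a point x is the solution l of
   l *m vertex_mx v = row_mx x 1; see bary_sum1 and bary_point. *)
Definition bary v (i : 'I_3) : {mpoly R[2]} :=
  \sum_(j < 2) invmx (vertex_mx v) (lshift 1 j) i *: 'X_j
  + (invmx (vertex_mx v) (rshift 2 ord0) i)%:MP.

(* P_k(T): since T has nonempty interior, a polynomial function on T is
   identified with the polynomial in the two Cartesian coordinates. *)
Definition Pk (k : nat) (p : {mpoly R[2]}) : Prop := (msize p <= k.+1)%N.

Definition Pspan v (k : nat) (S : {set 'X_{1..3 < k.+1}}) (p : {mpoly R[2]}) :
    Prop :=
  exists c : 'X_{1..3 < k.+1} -> R,
    p = \sum_(a in S) c a *: mmap1 (bary v) a.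

Definition direct_sum3 (V : zmodType) (W U0 U1 U2 : V -> Prop) : Prop :=
  (forall p, W p <->
     exists p0 p1 p2, [/\ U0 p0, U1 p1, U2 p2 & p = p0 + p1 + p2])
  /\ (forall p0 p1 p2 q0 q1 q2,
        U0 p0 -> U1 p1 -> U2 p2 -> U0 q0 -> U1 q1 -> U2 q2 ->
        p0 + p1 + p2 = q0 + q1 + q2 -> [/\ p0 = q0, p1 = q1 & p2 = q2]).

Lemma vertex_mx_unit v : is_triangle v -> vertex_mx v \in unitmx.
Proof.
move=> Tv.
have E0 : inord 0 = ord0 :> 'I_3 by apply/val_inj; rewrite /= inordK.
have E1 : inord 1 = lift ord0 ord0 :> 'I_3 by apply/val_inj; rewrite /= inordK.
have E2 : inord 2 = lift ord0 (lift ord0 ord0) :> 'I_3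
  by apply/val_inj; rewrite /= inordK.
rewrite -row_free_unit; apply/inj_row_free => u.
rewrite /vertex_mx (mul_mx_row u (\matrix_i v i) (const_mx 1)) => uM0.
have [uv u1] : u *m (\matrix_i v i) = 0 /\ u *m const_mx 1 = 0 :> 'M_(1, 1).
  by apply: eq_row_mx; rewrite row_mx0.
have s1 : u 0 (inord 0) = - (u 0 (inord 1) + u 0 (inord 2)).
  move/matrixP/(_ 0 0): u1.
  rewrite !mxE !big_ord_recl big_ord0 !mxE !mulr1 addr0.
  by rewrite E0 E1 E2 => /eqP; rewrite addr_eq0 => /eqP.
have s2 j : u 0 (inord 0) * v (inord 0) 0 j + u 0 (inord 1) * v (inord 1) 0 j
          + u 0 (inord 2) * v (inord 2) 0 j = 0.
  move/matrixP/(_ 0 j): uv.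
  by rewrite !mxE !big_ord_recl big_ord0 !mxE E0 E1 E2 addr0 addrA.
move/freeP: Tv => /(_ (fun i => u 0 (inord i.+1))).
rewrite !big_ord_recl big_ord0 /= addr0 => H.
have H' : forall i : 'I_2, u 0 (inord i.+1) = 0.
  apply: H; apply/rowP => j; rewrite !mxE /= -[RHS](s2 j) s1.
  by rewrite /bump /=; ring.
apply/rowP => i; rewrite [RHS]mxE.
have := H' ord0; have := H' (lift ord0 ord0); rewrite /= => h2 h1.
case: (unliftP ord0 i) => [j ->|->]; last by rewrite -E0 s1 h1 h2 addr0 oppr0.
by rewrite -(H' j); congr (u 0 _); apply/val_inj; rewrite /= inordK // ltnS.
Qed.

Lemma bary_col v (j : 'I_(2 + 1)) : is_triangle v ->
  \sum_i vertex_mx v i j *: bary v i =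
  \sum_(l < 2) (lshift 1 l == j)%:R *: 'X_l + (rshift 2 ord0 == j)%:R%:MP.
Proof.
move=> /vertex_mx_unit/mulVmx/matrixP Mv.
have MvE l : \sum_i invmx (vertex_mx v) l i * vertex_mx v i j = (l == j)%:R.
  by have := Mv l j; rewrite !mxE.
under eq_bigr do rewrite scalerDr scaler_sumr -mul_mpolyC -mpolyCM.
rewrite big_split /= exchange_big /=; congr (_ + _).
  apply: eq_bigr => l _; rewrite -MvE scaler_suml.
  by apply: eq_bigr => i _; rewrite scalerA mulrC.
rewrite -MvE raddf_sum /=.
by apply: eq_bigr => i _; rewrite mulrC.
Qed.

Lemma bary_sum1 v : is_triangle v -> \sum_i bary v i = 1.
Proof.
move=> /(bary_col (rshift 2 ord0)); rewrite eqxx [X in _ = X + _]big1.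
  rewrite add0r mpolyC1 => <-; apply: eq_bigr => i _.
  by rewrite row_mxEr mxE scale1r.
by move=> l _; rewrite eq_lrshift scale0r.
Qed.

Lemma bary_point v (j : 'I_2) :
  is_triangle v -> \sum_i v i 0 j *: bary v i = 'X_j.
Proof.
move=> /(bary_col (lshift 1 j)).
rewrite eq_rlshift mpolyC0 addr0 [X in _ = X](bigD1 j) //= eqxx scale1r.
rewrite [X in _ = _ + X]big1 => [|l /negbTE nlj]; last first.
  by rewrite (inj_eq (@lshift_inj _ _)) nlj scale0r.
rewrite addr0 => <-; apply: eq_bigr => i _.
by rewrite row_mxEl mxE.
Qed.

End Polynomials.

(* Main.v *)
Require Import Defs.
From mathcomp Require Import all_boot all_order all_algebra.
From mathcomp Require Import reals zify.
From mathcomp.multinomials Require Import mpoly.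

Set Implicit Arguments.
Unset Strict Implicit.
Unset Printing Implicit Defensive.

Import Order.TTheory GRing.Theory Num.Theory.
Local Open Scope ring_scope.

(** Put n = r^v + 1 and p = r^e + 1, so that the hypotheses become 2p <= n + 1
    and 2n <= k + 1 for natural numbers n, p (the value -1 is n = 0 or p = 0).
    A lattice point a lies within r^v of the vertex v_i iff a_i > k - n, and
    within r^e of the edge opposite to v_l iff a_l < p.

    The disjointness statements are then arithmetic. Two coordinates exceeding
    k - n would add up to at least 2(k - n + 1) > k, so the three vertex
    neighbourhoods are disjoint; two coordinates below p leave at least
    k - 2(p - 1) > k - n for the third, so a point close to two edges is
    already close to their common vertex ([disjoint_nbhd_vertex],
    [disjoint_S1_edge]). The cardinalities follow by counting points through two
    of their coordinates ([card_lattice_coords]): a vertex neighbourhood is a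
    lattice triangle with 1 + 2 + ... + n points, and the level a_l = x < p of
    an edge neighbourhood is cut by S_0 down to an interval of k + 1 - 2n + x
    points. The whole lattice is the vertex neighbourhood with n = k + 1.

    For the polynomials, the decomposition of the lattice is transported by the
    fact that the products lambda^a, a in the lattice, form a basis of P_k(T)
    ([Bernstein_span], [Bernstein_free]). A homogeneous form of degree k in
    three variables composed with (lambda_0, lambda_1, lambda_2) is obtained in
    two steps: an invertible linear change of variables, given by the inverse of
    the vertex matrix, and then dehomogenization, which sets the last variable
    to 1. The first step is an automorphism of the forms of degree k
    ([subst_linear_forms]), and the second is a bijection onto the polynomials
    of degree at most k ([homogenization], [dehomogenize_eq0]). *)

(** * Homogeneous forms and linear changes of variables *)

Section Substitution.
Variable R : comNzRingType.

Definition subst m n (h : 'I_m -> {mpoly R[n]}) : {mpoly R[m]} -> {mpoly R[n]} :=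
  mmap (@mpolyC n R) h.

Lemma substE m n (h : 'I_m -> {mpoly R[n]}) p :
  subst h p = \sum_(a <- msupp p) p@_a *: mmap1 h a.
Proof. by rewrite /subst /mmap; apply: eq_bigr => a _; rewrite mul_mpolyC. Qed.

Lemma substA l m n (h : 'I_l -> {mpoly R[m]}) (g : 'I_m -> {mpoly R[n]}) p :
  subst g (subst h p) = subst (fun i => subst g (h i)) p.
Proof.
rewrite [subst h p]substE [RHS]substE /subst raddf_sum /=.
apply: eq_bigr => a _; rewrite mmapZ mul_mpolyC /mmap1 rmorph_prod /=.
by congr (_ *: _); apply: eq_bigr => i _; rewrite rmorphXn.
Qed.

Lemma eq_subst m n (g h : 'I_m -> {mpoly R[n]}) : g =1 h -> subst g =1 subst h.
Proof.
by move=> gh p; rewrite !substE; apply: eq_bigr => a _; rewrite (mmap1_eq _ gh).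
Qed.

Lemma subst_id n (p : {mpoly R[n]}) : subst (fun i => 'X_i) p = p.
Proof.
by rewrite substE [RHS]mpolyE; apply: eq_bigr => a _; rewrite mmap1_id.
Qed.

Lemma subst_homog m n (h : 'I_m -> {mpoly R[n]}) k p :
  (forall i, h i \is 1.-homog) -> p \is k.-homog -> subst h p \is k.-homog.
Proof.
move=> h1 /dhomogP pk; rewrite substE big_seq; apply: rpred_sum => a /pk /= <-.
apply: rpredZ; rewrite mdegE /mmap1.
apply: (big_ind2 (fun (p : {mpoly R[n]}) d => p \is d.-homog)) => [|x d y e|i _].
- exact: dhomog1.
- exact: dhomogM.
by have := dhomogMn (a i) (h1 i); rewrite mul1n.
Qed.

(** The columns of A hold the forms, as in [bary], so that composing two such
    families multiplies the matrices in the order of [subst_linear_forms]. *)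
Definition linear_forms n (A : 'M[R]_n) (i : 'I_n) : {mpoly R[n]} :=
  \sum_j A j i *: 'X_j.

Lemma linear_forms_homog n (A : 'M[R]_n) i : linear_forms A i \is 1.-homog.
Proof. by apply: rpred_sum => j _; apply: rpredZ; rewrite dhomogX /= mdeg1. Qed.

Lemma subst_linear_forms n (A B : 'M[R]_n) p :
  subst (linear_forms B) (subst (linear_forms A) p)
  = subst (linear_forms (B *m A)) p.
Proof.
rewrite substA; apply: eq_subst => i; rewrite /linear_forms /subst raddf_sum /=.
under eq_bigr => j _.
  rewrite mmapZ mmapX mmap1U mul_mpolyC scaler_sumr.
  over.
rewrite exchange_big; apply: eq_bigr => l _; rewrite mxE scaler_suml.
by apply: eq_bigr => j _; rewrite scalerA mulrC.
Qed.

Lemma subst_linear_forms1 n (p : {mpoly R[n]}) :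
  subst (linear_forms 1%:M) p = p.
Proof.
rewrite -[RHS]subst_id; apply: eq_subst => i.
rewrite /linear_forms (bigD1 i) //= mxE eqxx scale1r big1 ?addr0 // => j /negbTE.
by rewrite mxE => ->; rewrite scale0r.
Qed.

(** Substituting these values sends homogeneous coordinates to the affine chart
    where the last coordinate is 1. *)
Definition affine_chart n (i : 'I_(n + 1)) : {mpoly R[n]} :=
  if split i is inl j then 'X_j else 1.

Lemma mmap1_affine_chart n (a : 'X_{1..n + 1}) :
  mmap1 (affine_chart (n:=n)) a = 'X_[[multinom a (lshift 1 j) | j < n]].
Proof.
rewrite /mmap1 big_split_ord /= [X in _ * X]big1 ?mulr1 => [|j _]; last first.
  by rewrite /affine_chart (unsplitK (inr j)) expr1n.
rewrite mpolyXE_id; apply: eq_bigr => j _.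
by rewrite /affine_chart (unsplitK (inl j)) mnmE.
Qed.

Lemma mdeg_lshift n (a : 'X_{1..n + 1}) :
  mdeg a = (mdeg [multinom a (lshift 1 j) | j < n] + a (rshift n ord0))%N.
Proof.
rewrite !mdegE big_split_ord big_ord1; congr (_ + _)%N.
by apply: eq_bigr => j _; rewrite mnmE.
Qed.

(** Setting the last variable to 1 loses no information on a form of known
    degree, because the last exponent of each monomial is determined by the
    others. *)
Lemma dehomogenize_eq0 n k (p : {mpoly R[n + 1]}) :
  p \is k.-homog -> subst (affine_chart (n:=n)) p = 0 -> p = 0.
Proof.
move=> pk p0; apply/mpolyP => a; rewrite mcoeff0.
have [ap|/memN_msupp_eq0//] := boolP (a \in msupp p).
have pP := dhomogP _ _ _ pk.
move/mpolyP/(_ [multinom a (lshift 1 j) | j < n]): p0.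
rewrite substE mcoeff0 raddf_sum /= (bigD1_seq a) ?msupp_uniq //=.
rewrite mcoeffZ mmap1_affine_chart mcoeffX eqxx mulr1.
rewrite big_seq_cond big1 ?addr0 // => b /andP[bp nba].
rewrite mcoeffZ mmap1_affine_chart mcoeffX.
case: eqP => [eba|]; last by rewrite mulr0.
case/eqP: nba; apply/mnmP => i.
have := pP _ ap; rewrite -(pP _ bp) /= !mdeg_lshift eba => /addnI ei.
rewrite -(splitK i); case: (split i) => j /=; last by rewrite ord1 ei.
by move/mnmP/(_ j): eba; rewrite !mnmE.
Qed.

Lemma homogenization n k (p : {mpoly R[n]}) : (msize p <= k.+1)%N ->
  exists2 q : {mpoly R[n + 1]}, q \is k.-homog & subst (affine_chart (n:=n)) q = p.
Proof.
move=> pk.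
pose h (a : 'X_{1..n}) : 'X_{1..n + 1} := [multinom
  if split i is inl j then a j else (k - mdeg a)%N | i < n + 1].
have hE a : [multinom h a (lshift 1 j) | j < n] = a.
  by apply/mnmP => j; rewrite !mnmE (unsplitK (inl j)).
exists (\sum_(a <- msupp p) p@_a *: 'X_[h a]).
  rewrite big_seq; apply: rpred_sum => a ap; apply: rpredZ.
  rewrite dhomogX /= mdeg_lshift hE mnmE (unsplitK (inr _)) subnKC //.
  by rewrite -ltnS (leq_trans _ pk) // msize_mdeg_lt.
rewrite /subst raddf_sum [RHS]mpolyE /=; apply: eq_bigr => a _.
by rewrite mmapZ mmapX mmap1_affine_chart hE mul_mpolyC.
Qed.

End Substitution.

Lemma msize_mmap1_le (R : idomainType) m n (h : 'I_m -> {mpoly R[n]}) a :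
  (forall i, msize (h i) <= 2)%N -> (msize (mmap1 h a) <= (mdeg a).+1)%N.
Proof.
have mulP (p q : {mpoly R[n]}) d e : (msize p <= d.+1 -> msize q <= e.+1 ->
    msize (p * q) <= (d + e).+1)%N.
  have [->|p0] := eqVneq p 0; first by rewrite mul0r msize0.
  have [->|q0] := eqVneq q 0; first by rewrite mulr0 msize0.
  by rewrite msizeM //; lia.
move=> h2; rewrite mdegE /mmap1.
apply: (big_ind2 (fun (p : {mpoly R[n]}) d => msize p <= d.+1)%N) => [|x d y e|i _].
- by rewrite msize1.
- exact: mulP.
elim: (a i) => [|d IHd]; first by rewrite msize1.
by rewrite exprS -[d.+1]add1n; apply: mulP.
Qed.

(** * The Bernstein basis *)

Section Bernstein.
Variables (R : realType) (v : 'I_3 -> 'rV[R]_2) (k : nat).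

(** The barycentric coordinates are linear forms in (X_0, X_1, 1). *)
Lemma baryE i :
  bary v i = subst (@affine_chart R 2) (linear_forms (invmx (vertex_mx v)) i).
Proof.
rewrite /linear_forms /subst raddf_sum /=.
under eq_bigr => j _ do rewrite mmapZ mmapX mmap1U mul_mpolyC.
rewrite (@big_split_ord _ _ _ 2 1) big_ord1 /bary; congr (_ + _).
  by apply: eq_bigr => j _; rewrite /affine_chart (unsplitK (inl j)).
by rewrite /affine_chart (unsplitK (inr ord0)) -mul_mpolyC mulr1.
Qed.

Lemma subst_bary p : subst (bary v) p =
  subst (@affine_chart R 2) (subst (linear_forms (invmx (vertex_mx v))) p).
Proof. by rewrite [RHS]substA; apply: eq_subst => i; rewrite baryE. Qed.

Lemma msize_bary i : (msize (bary v i) <= 2)%N.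
Proof.
apply: leq_trans (msizeD_le _ _) _; rewrite geq_max; apply/andP; split.
  apply: leq_trans (msize_sum _ _ _) _; apply/bigmax_leqP => j _.
  by apply: leq_trans (msizeZ_le _ _) _; rewrite msizeX mdeg1.
by rewrite msizeC; case: eqP.
Qed.

Lemma Pspan_Pk (S : {set 'X_{1..3 < k.+1}}) p :
  S \subset lattice k -> Pspan v S p -> Pk k p.
Proof.
move=> /subsetP sS [c ->]; apply: leq_trans (msize_sum _ _ _) _.
apply/bigmax_leqP => a /sS; rewrite inE => /eqP ak.
apply: leq_trans (msizeZ_le _ _) _.
by have := msize_mmap1_le a msize_bary; rewrite ak.
Qed.

Hypothesis Tv : is_triangle v.

Lemma Bernstein_span p : Pk k p -> Pspan v (lattice k) p.
Proof.
move=> /homogenization[q qk qp].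
pose F := subst (linear_forms (vertex_mx v)) q.
have Fk : F \is k.-homog by apply: subst_homog => // i; apply: linear_forms_homog.
have Fs : (msize F <= k.+1)%N.
  rewrite msizeE; apply/bigmax_leqP_seq => a aF _.
  by have /= -> := dhomogP _ _ _ Fk a aF.
(* F is the form q in the coordinates in which the vertices of the triangle
   are the unit vectors, so its coefficients are those of p on the lambda^a. *)
exists (fun a => F@_a).
have -> : p = subst (bary v) F.
  rewrite subst_bary subst_linear_forms mulVmx ?vertex_mx_unit //.
  by rewrite subst_linear_forms1.
rewrite /subst (mmapE _ Fs) [LHS](bigID (mem (lattice k))) /=.
rewrite [X in _ + X]big1 ?addr0 => [|a].
  by apply: eq_bigr => a _; rewrite mul_mpolyC.
by rewrite inE => ak; rewrite (dhomog_nemf_coeff Fk ak) mpolyC0 mul0r.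
Qed.

Lemma Bernstein_free (c : 'X_{1..3 < k.+1} -> R) :
  \sum_(a in lattice k) c a *: mmap1 (bary v) a = 0 ->
  {in lattice k, forall a, c a = 0}.
Proof.
pose F : {mpoly R[3]} := \sum_(a in lattice k) c a *: 'X_[a].
have Fk : F \is k.-homog.
  apply: rpred_sum => a; rewrite inE => ak; apply: rpredZ.
  by rewrite dhomogX.
have -> : \sum_(a in lattice k) c a *: mmap1 (bary v) a = subst (bary v) F.
  rewrite /F /subst raddf_sum; apply: eq_bigr => a _ /=.
  by rewrite mmapZ mmapX mul_mpolyC.
rewrite subst_bary => /(dehomogenize_eq0 _)-/(_ k) F0 a aL.
have {}F0 : F = 0.
  rewrite -[F]subst_linear_forms1 -(mulmxV (vertex_mx_unit Tv)).
  rewrite -subst_linear_forms F0; first by rewrite substE msupp0 big_nil.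
  by apply: subst_homog => // i; apply: linear_forms_homog.
move/mpolyP/(_ a): F0; rewrite mcoeff0 raddf_sum /= (bigD1 a) //=.
rewrite mcoeffZ mcoeffX eqxx mulr1 big1 ?addr0 // => b /andP[_ nba].
by rewrite mcoeffZ mcoeffX -bmeqP (negbTE nba) mulr0.
Qed.

End Bernstein.

(** * Direct sums from partitions of a free family *)

Section DirectSum.
Variables (R : pzRingType) (V : lmodType R) (I : finType) (b : I -> V).

Definition spanned (A : {set I}) (p : V) : Prop :=
  exists c : I -> R, p = \sum_(i in A) c i *: b i.

Lemma big_setU3 (A0 A1 A2 : {set I}) (F : I -> V) :
  [disjoint A0 & A1] -> [disjoint A0 & A2] -> [disjoint A1 & A2] ->
  \sum_(i in A0 :|: A1 :|: A2) F i
  = \sum_(i in A0) F i + \sum_(i in A1) F i + \sum_(i in A2) F i.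
Proof.
move=> d01 d02 d12; have d : [disjoint A0 :|: A1 & A2].
  by rewrite -setI_eq0 setIUl setU_eq0 !setI_eq0 d02.
have sumU (A B : {set I}) : [disjoint A & B] ->
    \sum_(i in A :|: B) F i = \sum_(i in A) F i + \sum_(i in B) F i.
  by move=> dAB; rewrite -bigU //; apply: eq_bigl => i; rewrite !inE.
by rewrite !sumU.
Qed.

Lemma direct_sum3_spanned (A A0 A1 A2 : {set I}) :
  A = A0 :|: A1 :|: A2 ->
  [disjoint A0 & A1] -> [disjoint A0 & A2] -> [disjoint A1 & A2] ->
  (forall c : I -> R, \sum_(i in A) c i *: b i = 0 -> {in A, forall i, c i = 0}) ->
  direct_sum3 (spanned A) (spanned A0) (spanned A1) (spanned A2).
Proof.
move=> defA d01 d02 d12 Afree.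
(* The three coefficient families agree with a single one on the union,
   so that freeness on the union compares them all at once. *)
pose glue (c0 c1 c2 : I -> R) i :=
  if i \in A0 then c0 i else if i \in A1 then c1 i else c2 i.
have glue0 c0 c1 c2 : {in A0, glue c0 c1 c2 =1 c0} by move=> i; rewrite /glue => ->.
have glue1 c0 c1 c2 : {in A1, glue c0 c1 c2 =1 c1}.
  by move=> i i1; rewrite /glue i1 (disjointFl d01).
have glue2 c0 c1 c2 : {in A2, glue c0 c1 c2 =1 c2}.
  by move=> i i2; rewrite /glue (disjointFl d02) // (disjointFl d12).
have sumA c0 c1 c2 : \sum_(i in A) glue c0 c1 c2 i *: b i
  = \sum_(i in A0) c0 i *: b i + \sum_(i in A1) c1 i *: b i
    + \sum_(i in A2) c2 i *: b i.
  rewrite defA big_setU3 //; congr (_ + _ + _); apply: eq_bigr => i iA.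
  - by rewrite glue0.
  - by rewrite glue1.
  - by rewrite glue2.
split=> [p|p0 p1 p2 q0 q1 q2].
  split=> [[c ->]|[p0 [p1 [p2 [[c0 ->] [c1 ->] [c2 ->] ->]]]]]; last first.
    by exists (glue c0 c1 c2); rewrite sumA.
  exists (\sum_(i in A0) c i *: b i), (\sum_(i in A1) c i *: b i),
    (\sum_(i in A2) c i *: b i).
  by split; [exists c | exists c | exists c | rewrite defA big_setU3].
move=> [c0 ->] [c1 ->] [c2 ->] [d0 ->] [d1 ->] [d2 ->] /eqP.
rewrite -!sumA -subr_eq0 -sumrB => /eqP e0.
have {}e0 : {in A, glue c0 c1 c2 =1 glue d0 d1 d2}.
  move=> i iA; apply/eqP; rewrite -subr_eq0; apply/eqP; move: i iA.
  by apply: Afree; rewrite -[RHS]e0; apply: eq_bigr => i _; rewrite scalerBl.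
split; apply: eq_bigr => i iA; congr (_ *: _).
- by rewrite -(glue0 c0 c1 c2) // e0 ?glue0 // defA !inE iA.
- by rewrite -(glue1 c0 c1 c2) // e0 ?glue1 // defA !inE iA ?orbT.
- by rewrite -(glue2 c0 c1 c2) // e0 ?glue2 // defA !inE iA ?orbT.
Qed.

End DirectSum.

(** * Neighbourhoods in the lattice *)

Section LatticeCounting.
Variable k : nat.
Implicit Types (a : 'X_{1..3 < k.+1}) (l i : 'I_3).

Lemma faces0E : faces 0 = [set [set i] | i : 'I_3].
Proof.
apply/setP => f; rewrite inE; apply/cards1P/imsetP => [[i ->]|[i _ ->]].
  by exists i.
by exists i.
Qed.

Lemma faces1E : faces 1 = [set ~: [set l] | l : 'I_3].
Proof.
apply/setP => f; rewrite inE; apply/idP/imsetP => [f2|[l _ ->]]; last first.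
  by rewrite cardsC1 card_ord.
have /eqP/cards1P[l fl] : #|~: f| = 1%N.
  by have := cardsC f; rewrite (eqP f2) card_ord => - [].
by exists l => //; rewrite -fl setCK.
Qed.

(** Choosing two of the three vertices determines the third; this replaces a
    case analysis on the vertices throughout. *)
Lemma third_vertex l i : l != i -> exists2 o : 'I_3, o != l /\ o != i &
  forall F : 'I_3 -> nat, (\sum_j F j = F l + F i + F o)%N.
Proof.
move=> li; have /eqP/cards1P[o Eo] : #|~: [set l; i]| = 1%N.
  by have := cardsC [set l; i]; rewrite cards2 li card_ord => - [].
have oE j : (j == o) = (j != l) && (j != i).
  by move/setP/(_ j): Eo; rewrite !inE negb_or.
exists o => [|F]; first by apply/andP; rewrite -oE.
rewrite (bigD1 l) //= (bigD1 i) 1?eq_sym //= (big_pred1 o) ?addnA //.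
by move=> j; rewrite /= oE.
Qed.

Lemma dist_edge a l : dist a (~: [set l]) = a l.
Proof. by rewrite /dist (big_pred1 l) // => j; rewrite !inE negbK. Qed.

Lemma dist_vertex a i : a \in lattice k -> (dist a [set i] + a i)%N = k.
Proof.
rewrite inE mdegE => /eqP ak; rewrite -[RHS]ak [RHS](bigD1 i) //= addnC.
by congr (_ + _)%N; apply: eq_bigl => j; rewrite !inE.
Qed.

Lemma lattice_le a i : a \in lattice k -> (a i <= k)%N.
Proof. by move=> /(dist_vertex i) ak; rewrite -[leqRHS]ak leq_addl. Qed.

(** Two coordinates of a lattice point determine the third, so the points
    correspond to the pairs (x, y) with x + y <= k. *)
Lemma card_lattice_coords (P : nat -> nat -> bool) l i : l != i ->
  #|[set a in lattice k | P (a l) (a i)]|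
  = (\sum_(x < k.+1) \sum_(y < k.+1) ((x + y <= k) && P x y))%N.
Proof.
move=> li; have [o [ol oi] sum3] := third_vertex li.
pose A := [set a in lattice k | P (a l) (a i)].
pose f a : 'I_k.+1 * 'I_k.+1 := (inord (a l), inord (a i)).
have AP a : a \in A -> a \in lattice k /\ P (a l) (a i).
  by rewrite inE => /andP.
have lattice_sum a : a \in lattice k -> (a l + a i + a o)%N = k.
  by rewrite inE mdegE sum3 => /eqP.
have fE a : a \in lattice k -> (f a).1 = a l :> nat /\ (f a).2 = a i :> nat.
  by move=> aL; rewrite !inordK // ltnS lattice_le.
have f_inj : {in A &, injective f}.
  move=> a b /AP[aL _] /AP[bL _] fab.
  have [al ai] := fE a aL; have [bl bi] := fE b bL.
  have {}al : a l = b l by rewrite -al -bl fab.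
  have {}ai : a i = b i by rewrite -ai -bi fab.
  apply/val_inj/mnmP => j /=.
  have [->//|jl] := eqVneq j l; have [->//|ji] := eqVneq j i.
  have -> : j = o.
    apply/eqP; have := sum3 (fun x => x == j : nat).
    rewrite (bigD1 j) //= eqxx ![_ == j]eq_sym (negbTE jl) (negbTE ji).
    by case: eqP.
  by have := lattice_sum a aL; have := lattice_sum b bL; rewrite al ai; lia.
rewrite -/A -(card_in_imset f_inj).
have -> : f @: A =
    [set xy : 'I_k.+1 * 'I_k.+1 | (xy.1 + xy.2 <= k)%N && P xy.1 xy.2].
  apply/setP => -[x y]; rewrite inE /=; apply/imsetP/andP => [[a /AP[aL Pa] fa]|].
    have [] := fE a aL; rewrite -fa /= => -> ->; split=> //.
    by rewrite -[leqRHS](lattice_sum a aL) leq_addr.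
  move=> [xyk Pxy].
  pose m : 'X_{1..3} := [multinom if j == l then x : nat else
     if j == i then y : nat else (k - (x + y))%N | j < 3].
  have [ml mi mo] : [/\ m l = x, m i = y & m o = (k - (x + y))%N].
    rewrite !mnmE eqxx (negbTE ol) (negbTE oi) eq_sym (negbTE li) eqxx; split=> //.
  have mk : mdeg m = k by rewrite mdegE sum3 ml mi mo subnKC.
  have mB : (mdeg m < k.+1)%N by rewrite mk.
  exists (BMultinom mB); first by rewrite !inE /= mk eqxx ml mi.
  by congr pair; apply/val_inj; rewrite /= ?ml ?mi inordK.
rewrite pair_bigA -sum1_card [LHS]big_mkcond /=; apply: eq_bigr => -[x y] _.
by rewrite inE /=; case: (_ && _).
Qed.

Lemma sum_interval N lo hi : (lo <= hi <= N)%N ->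
  (\sum_(y < N) (lo <= y < hi) = hi - lo)%N.
Proof.
move=> /andP[lh hN]; rewrite -(big_mkord xpredT (fun y => (lo <= y < hi) : nat)).
rewrite (big_cat_nat (n := hi)) //= (big_cat_nat (n := lo)) //=.
rewrite big_nat big1 => [|y yl]; last by case: (leqP lo y) yl; lia.
rewrite [X in (_ + X)%N]big_nat [X in (_ + X)%N]big1 => [|y]; last by lia.
rewrite (eq_big_nat _ _ (F2 := fun=> 1%N)) => [|y ->] //.
by rewrite sum_nat_const_nat; lia.
Qed.

Lemma in_nbhd_vertex (n : nat) a i :
  (a \in nbhd k [set i] (n%:Z - 1)) = (a \in lattice k) && (k < a i + n)%N.
Proof.
rewrite in_set; case: (boolP (a \in lattice k)) => //= /(@dist_vertex _ i).
by lia.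
Qed.

Lemma in_S0 (n : nat) a : (a \in S0 k (n%:Z - 1)) =
  (a \in lattice k) && [exists i, (k < a i + n)%N].
Proof.
rewrite /S0 faces0E; apply/bigcupP/andP => [[_ /imsetP[i _ ->]]|[aL /existsP[i ai]]].
  by rewrite in_nbhd_vertex => /andP[-> ai]; split=> //; apply/existsP; exists i.
by exists [set i]; [apply: imset_f | rewrite in_nbhd_vertex aL].
Qed.

Lemma in_S1_edge (n p : nat) a l :
  (a \in S1_edge k (n%:Z - 1) (p%:Z - 1) (~: [set l])) =
  [&& a \in lattice k, (a l < p)%N & [forall i, (a i + n <= k)%N]].
Proof.
rewrite in_setD in_S0 [a \in nbhd _ _ _]in_set dist_edge.
case: (a \in lattice k) => //=.
rewrite andbC; congr (_ && _); first by lia.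
by rewrite negb_exists; apply: eq_forallb => i; rewrite -leqNgt.
Qed.

Lemma in_S1 (n p : nat) a : (a \in S1 k (n%:Z - 1) (p%:Z - 1)) =
  [exists l, a \in S1_edge k (n%:Z - 1) (p%:Z - 1) (~: [set l])].
Proof.
rewrite /S1 faces1E; apply/bigcupP/existsP => [[_ /imsetP[l _ ->] al]|[l al]].
  by exists l.
by exists (~: [set l]); first apply: imset_f.
Qed.

Lemma card_nbhd_vertex n i : (n <= k.+1)%N ->
  #|nbhd k [set i] (n%:Z - 1)| = 'C(n.+1, 2).
Proof.
move=> nk; have [j ij] : exists j, i != j.
  by exists (if i == ord0 then ord_max else ord0); case: (eqVneq i ord0) => [->|].
have -> : nbhd k [set i] (n%:Z - 1)
    = [set a in lattice k | (k < a i + n)%N].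
  by apply/setP => a; rewrite in_nbhd_vertex in_set.
(* Reversing the order of summation makes x the distance to the vertex. *)
rewrite (card_lattice_coords (fun x _ => k < x + n)%N ij) (reindex_inj rev_ord_inj) /=.
transitivity (\sum_(x < k.+1 | (x < n)%N) x.+1)%N.
  rewrite [RHS]big_mkcond; apply: eq_bigr => x _.
  rewrite -[RHS]subn0; under eq_bigr => y _.
    rewrite (_ : _ && _ = (0 <= y < if (x < n)%N then x.+1 else 0%N)%N); last first.
      by have := ltn_ord x; case: ifP; lia.
    over.
  by rewrite sum_interval //; have := ltn_ord x; case: ifP; lia.
rewrite -(big_ord_widen _ (fun x => x.+1)) //.
by rewrite -bin2_sum big_mkord big_ord_recl add0n.
Qed.

(** Every lattice point is within distance k of any given vertex. *)
Lemma card_lattice : #|lattice k| = 'C(k.+2, 2).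
Proof.
rewrite -(card_nbhd_vertex ord0 (leqnn k.+1)); apply: eq_card => a.
by rewrite in_nbhd_vertex addnS ltnS leq_addl andbT.
Qed.

(** On the level a_l = x, the points outside the neighbourhoods of the two
    vertices of the edge are those with n - x <= a_i <= k - n; since p <= n <=
    k + 1 - n, the vertex v_l opposite to the edge excludes nothing more. *)
Lemma card_S1_edge (n p : nat) l : (p.*2 <= n.+1)%N -> (n.*2 <= k.+1)%N ->
  #|S1_edge k (n%:Z - 1) (p%:Z - 1) (~: [set l])|
  = (\sum_(x < p) (k.+1 - n.*2 + x))%N.
Proof.
move=> pn nk; have [i li] : exists i, l != i.
  by exists (if l == ord0 then ord_max else ord0); case: (eqVneq l ord0) => [->|].
have [o _ sum3] := third_vertex li.
have -> : S1_edge k (n%:Z - 1) (p%:Z - 1) (~: [set l]) = [set a in lattice k |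
    [&& a l < p, n <= a l + a i & a i + n <= k]%N].
  apply/setP => a; rewrite in_S1_edge in_set; case: (boolP (a \in lattice k)) => //= aL.
  have aS : (a l + a i + a o)%N = k by move: aL; rewrite inE mdegE sum3 => /eqP.
  case: (ltnP (a l) p) => //= alp; apply/forallP/idP => [a_le|a_le j].
    by have := a_le i; have := a_le o; lia.
  (* Summing the indicator of j shows that j is one of l, i and o. *)
  have := sum3 (fun x => x == j : nat); rewrite (bigD1 j) //= eqxx.
  by case: eqP => [<-|_]; [|case: eqP => [<-|_]; [|case: eqP => [<-|_]]]; lia.
rewrite (card_lattice_coords
  (fun x y => [&& x < p, n <= x + y & y + n <= k]%N) li).
transitivity (\sum_(x < k.+1 | (x < p)%N) (k.+1 - n.*2 + x))%N; last first.
  by rewrite -(big_ord_widen _ (fun x => k.+1 - n.*2 + x)%N) //; lia.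
rewrite [RHS]big_mkcond; apply: eq_bigr => x _.
case: ifP => xp; last by rewrite big1 // => y _; rewrite andbF.
under eq_bigr => y _.
  rewrite (_ : _ && _ = (n - x <= y < k.+1 - n)%N); last lia.
  over.
by rewrite sum_interval; lia.
Qed.

(** Two coordinates larger than k - n would add up to more than k. *)
Lemma disjoint_nbhd_vertex (n : nat) i j : (n.*2 <= k.+1)%N -> i != j ->
  [disjoint nbhd k [set i] (n%:Z - 1) & nbhd k [set j] (n%:Z - 1)].
Proof.
move=> nk ij; have [o _ sum3] := third_vertex ij.
apply/pred0P => a /=; rewrite !in_nbhd_vertex; apply/negbTE/negP.
move=> /andP[/andP[aL ai] /andP[_ aj]]; move: aL.
by rewrite inE mdegE sum3 => /eqP; lia.
Qed.

(** A point close to two edges is close to their common vertex, hence was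
    removed with S_0. *)
Lemma disjoint_S1_edge (n p : nat) l i : (p.*2 <= n.+1)%N -> l != i ->
  [disjoint S1_edge k (n%:Z - 1) (p%:Z - 1) (~: [set l])
          & S1_edge k (n%:Z - 1) (p%:Z - 1) (~: [set i])].
Proof.
move=> pn li; have [o _ sum3] := third_vertex li.
apply/pred0P => a /=; rewrite !in_S1_edge; apply/negbTE/negP.
move=> /andP[/and3P[aL al /forallP/(_ o) ao] /and3P[_ ai _]]; move: aL.
by rewrite inE mdegE sum3 => /eqP; lia.
Qed.

Lemma card_S0 (n : nat) : (n.*2 <= k.+1)%N ->
  #|S0 k (n%:Z - 1)| = (3 * 'C(n.+1, 2))%N.
Proof.
move=> nk; rewrite /S0 faces0E big_imset /=; last by move=> i j _ _; apply: set1_inj.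
rewrite -sum1_card partition_disjoint_bigcup; last first.
  by move=> i j; apply: disjoint_nbhd_vertex.
have nk1 : (n <= k.+1)%N by lia.
under eq_bigr => i _ do rewrite sum1_card card_nbhd_vertex //.
by rewrite sum_nat_const card_ord.
Qed.

Lemma card_S1 (n p : nat) : (p.*2 <= n.+1)%N -> (n.*2 <= k.+1)%N ->
  #|S1 k (n%:Z - 1) (p%:Z - 1)|
  = (3 * \sum_(x < p) (k.+1 - n.*2 + x))%N.
Proof.
move=> pn nk; rewrite /S1 faces1E big_imset /=; last by move=> i j _ _ /setC_inj/set1_inj.
rewrite -sum1_card partition_disjoint_bigcup; last first.
  by move=> l i; apply: disjoint_S1_edge.
under eq_bigr => i _ do rewrite sum1_card card_S1_edge //.
by rewrite sum_nat_const card_ord.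
Qed.

End LatticeCounting.

(** * The decomposition *)

Theorem lemma3p5 (R : realType) (re rv m : int) (k : nat)
    (v : 'I_3 -> 'rV[R]_2) :
  re = m -> -1 <= m ->
  Num.max (2 * re) (-1) <= rv ->
  2 * rv + 1 <= k%:Z ->
  4 * m + 1 <= 2 * rv + 1 ->
  is_triangle v ->
  [/\ [/\ lattice k = S0 k rv :|: S1 k rv re :|: S2 k rv re,
          [disjoint S0 k rv & S1 k rv re],
          [disjoint S0 k rv & S2 k rv re]
        & [disjoint S1 k rv re & S2 k rv re]],
      {in faces 1 &, forall e e', e != e' ->
         [disjoint S1_edge k rv re e & S1_edge k rv re e']},
      [/\ #|S0 k rv| = (3 * 'C(absz (rv + 2)%R, 2))%N,
          #|S1 k rv re|%:Z
            = 3 * \sum_(0 <= i < absz (re + 1)%R) (k%:Z - 1 - 2 * rv + i%:Z)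
        & #|S2 k rv re|%:Z
            = 'C(k + 2, 2)%:Z - #|S0 k rv|%:Z - #|S1 k rv re|%:Z]
    & direct_sum3 (@Pk R k)
        (Pspan v (S0 k rv)) (Pspan v (S1 k rv re)) (Pspan v (S2 k rv re))].
Proof.
move=> -> m_ge; rewrite ge_max => /andP[rv_ge2m rv_ge] k_ge _ Tv.
have [p def_m] : exists p : nat, m = p%:Z - 1 by exists (absz (m + 1)); lia.
have [n def_rv] : exists n : nat, rv = n%:Z - 1 by exists (absz (rv + 1)); lia.
have pn : (p.*2 <= n.+1)%N by lia.
have nk : (n.*2 <= k.+1)%N by lia.
rewrite {m_ge rv_ge2m rv_ge k_ge m re}def_m {rv}def_rv.
set A0 := S0 k _; set A1 := S1 k _ _; set A2 := S2 k _ _.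
have A0L : A0 \subset lattice k by apply/subsetP => a; rewrite in_S0 => /andP[].
have A1L : A1 \subset lattice k.
  by apply/subsetP => a; rewrite in_S1 => /existsP[l]; rewrite in_S1_edge => /andP[].
have A01L : A0 :|: A1 \subset lattice k by rewrite subUset A0L.
have defL : lattice k = A0 :|: A1 :|: A2.
  by rewrite -{1}(setID (lattice k) (A0 :|: A1)) (setIidPr A01L).
have d01 : [disjoint A0 & A1].
  apply/pred0P => a /=; rewrite in_S1; apply/negbTE/andP => -[a0 /existsP[l]].
  by rewrite in_setD a0.
have d2 : [disjoint A0 :|: A1 & A2].
  by rewrite -setI_eq0 /A2 /S2 setIDA setDIl setDv set0I.
have [d02 d12] : [disjoint A0 & A2] /\ [disjoint A1 & A2].
  by split; apply: disjointWl d2; [apply: subsetUl | apply: subsetUr].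
split=> //.
- move=> e e'; rewrite !faces1E => /imsetP[l _ ->] /imsetP[i _ ->] li.
  by apply: disjoint_S1_edge => //; apply: contraNneq li => ->.
- have -> : absz (n%:Z - 1 + 2) = n.+1 by lia.
  have -> : absz (p%:Z - 1 + 1) = p by lia.
  split; first exact: card_S0.
    rewrite card_S1 // PoszM big_mkord; congr (_ * _).
    rewrite (big_morph _ PoszD (erefl (Posz 0))); apply: eq_bigr => i _.
    by lia.
  rewrite addn2 -card_lattice defL -setI_eq0 in d2 *.
  by have := cardsUI (A0 :|: A1) A2; have := cardsUI A0 A1;
    rewrite (eqP d2) (disjoint_setI0 d01) cards0; lia.
have PkE q : Pk k q <->
    spanned (fun a : 'X_{1..3 < k.+1} => mmap1 (bary v) a) (lattice k) q.
  by split; [apply: Bernstein_span | apply: Pspan_Pk].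
have [sumP uniqP] := direct_sum3_spanned defL d01 d02 d12 (Bernstein_free Tv).
by split=> // q; rewrite PkE.
Qed.
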